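(* Let $\Lambda$ be a basic self-injective (hence Frobenius) finite-dimensional $\Bbbk$-algebra with decomposition $\Lambda\cong P_1\oplus\cdots\oplus P_n$ into indecomposable projective right modules and Nakayama permutation $\nu$, let $m(1),\dots,m(n)$ be positive integers, and let $$A=\Lambda(m(1),\cdots,m(n)):=\mathrm{End}_{\Lambda}\left(P_1^{m(1)}\oplus\cdots\oplus P_n^{m(n)}\right).$$ Let $$y=\sum_{i,j}\sum_{\bullet}\varphi_{\bullet,j\leftarrow i}\otimes\psi_{\bullet,\nu^{-1}(i)\leftarrow j}\in\Lambda\otimes\Lambda,\qquad \varphi_{\bullet,j\leftarrow i}\in\Lambda_{j\leftarrow i},\ \psi_{\bullet,\nu^{-1}(i)\leftarrow j}\in\Lambda_{\nu^{-1}(i)\leftarrow j},$$ be an element inducing a coassociative counital comultiplication on $\Lambda$, and fix, for every $1\le i\le n$, a set $$\mathcal{S}(i)\subseteq\{1,\cdots,m(i)\}\times\{1,\cdots,m(\nu^{-1}i)\}.$$ Then the element $$x:=\sum_{i,j}\sum_{t=1}^{m(j)}\sum_{\bullet}\sum_{(s,s')\in\mathcal{S}(i)}\varphi^{t\leftarrow s}_{\bullet,j\leftarrow i}\otimes\psi^{s'\leftarrow t}_{\bullet,\nu^{-1}(i)\leftarrow j}\in A\otimes A$$ is invariant in the $A$-bimodule $A\otimes A$ (that is, $ax=xa$ for all $a\in A$), and hence induces a coassociative bimodule comultiplication $A\to A\otimes A$, $a\mapsto ax=xa$.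
   Context: Algebras are unital, associative and finite-dimensional over a field $\Bbbk$; $\otimes=\otimes_{\Bbbk}$. For an algebra $B$, the $B$-bimodule structure on $B\otimes B$ is $a(b\otimes c)d=ab\otimes cd$. An element $y\in B\otimes B$ is invariant if $ay=ya$ for all $a\in B$; such a $y$ induces the $B$-bimodule map $\Delta:B\to B\otimes B$, $\Delta(a)=ay=ya$. ''$y$ induces a coassociative counital comultiplication'' means that $y$ is invariant and this $\Delta$ is coassociative and has a counit $\varepsilon\in B^*$, i.e. $(\varepsilon\otimes\mathrm{id})\Delta=\mathrm{id}=(\mathrm{id}\otimes\varepsilon)\Delta$. $\Lambda$ is basic if, in a decomposition $\Lambda\cong P_1\oplus\cdots\oplus P_n$ into indecomposable projective right $\Lambda$-modules, $P_i\not\cong P_j$ for $i\neq j$. $\mathrm{End}_\Lambda$ and $\mathrm{Hom}_\Lambda$ refer to right-module morphisms, with product given by composition; $\Lambda$ is identified with $\mathrm{End}_\Lambda(P_1\oplus\cdots\oplus P_n)$ (left multiplication). The Nakayama permutation $\nu$ of $\{1,\dots,n\}$ is determined by $\mathrm{soc}(P_i)\cong\mathrm{top}(P_{\nu(i)})$. $\Lambda_{j\leftarrow i}\subset\Lambda$ denotes the space of $\Lambda$-morphisms $P_i\to P_j$, extended by zero on the other summands. The inner sums $\sum_\bullet$ are finite sums over an auxiliary index (depending on $i,j$), so that the form of $y$ expresses that $y\in\bigoplus_{i,j}\Lambda_{j\leftarrow i}\otimes\Lambda_{\nu^{-1}(i)\leftarrow j}$. Write $P_i^{m(i)}=\bigoplus_{s=1}^{m(i)}P_{is}$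 with fixed identifications $P_{is}\cong P_i$. For a morphism $\varphi:P_i\to P_j$ and $1\le s\le m(i)$, $1\le t\le m(j)$, $\varphi^{t\leftarrow s}\in A$ denotes the corresponding morphism $P_{is}\to P_{jt}$ (via these identifications), extended by zero on all other summands of $P_1^{m(1)}\oplus\cdots\oplus P_n^{m(n)}$. *)

(* Defs.v *)
From HB Require Import structures.
From mathcomp Require Import all_boot all_order all_fingroup all_algebra all_field.

Set Implicit Arguments.
Unset Strict Implicit.
Unset Printing Implicit Defensive.

Import GRing.Theory.
Local Open Scope ring_scope.

Reserved Notation "u *t v" (at level 40, v at level 39, no associativity).

(* The tensor product over F, as matrices of coordinates in the bases of U and
   V provided by their vectType structures; [tlift_tens] and [tensor_ext] below
   state its universal property. *)
Section Tensor.
Import VectorInternalTheory.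
Variable F : fieldType.

Definition tensor (U V : vectType F) : Type := 'M[F]_(dim U, dim V).
HB.instance Definition _ (U V : vectType F) := Vector.on (tensor U V).

Definition tens (U V : vectType F) (u : U) (v : V) : tensor U V :=
  (v2r u)^T *m v2r v.

Definition can_basis (U : vectType F) (i : 'I_(dim U)) : U :=
  r2v (delta_mx 0 i).

Definition tlift (U V W : vectType F) (f : U -> V -> W) (z : tensor U V) : W :=
  \sum_i \sum_j z i j *: f (can_basis i) (can_basis j).

End Tensor.

Notation "u *t v" := (tens u v) : ring_scope.

Section TensorTheory.
Import VectorInternalTheory.
Variables (F : fieldType) (U V W : vectType F).

Definition bilinear2 (f : U -> V -> W) :=
  (forall u, linear (f u)) /\ (forall v, linear (f^~ v)).

Lemma tens_linearr (u : U) : linear (fun v : V => u *t v).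
Proof. by move=> a v w; rewrite /tens linearP /= mulmxDr -scalemxAr. Qed.

Lemma tens_linearl (v : V) : linear (fun u : U => u *t v).
Proof. by move=> a u w; rewrite /tens linearP /= linearP /= mulmxDl -scalemxAl. Qed.

Lemma tlift_linear (f : U -> V -> W) : linear (tlift f).
Proof.
move=> a x y; rewrite /tlift scaler_sumr -big_split; apply: eq_bigr => i _ /=.
rewrite scaler_sumr -big_split; apply: eq_bigr => j _ /=.
by rewrite !mxE scalerDl scalerA.
Qed.

HB.instance Definition _ (f : U -> V -> W) :=
  GRing.isLinear.Build F (tensor U V) W *:%R (tlift f) (tlift_linear f).

Lemma can_basis_sum (T : vectType F) (u : T) :
  u = \sum_i v2r u 0 i *: can_basis i.
Proof.
apply: v2r_inj; rewrite {1}[v2r u]row_sum_delta linear_sum /=.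
by apply: eq_bigr => i _; rewrite linearZ /= r2vK.
Qed.

Lemma tensor_sum (z : tensor U V) :
  z = \sum_i \sum_j z i j *: (can_basis i *t can_basis j).
Proof.
rewrite {1}[z]matrix_sum_delta; apply: eq_bigr => i _; apply: eq_bigr => j _.
congr (_ *: _); rewrite /tens !r2vK; apply/matrixP => k l.
by rewrite !mxE big_ord1 !mxE /= -natrM mulnb.
Qed.

Lemma tlift_tens (f : U -> V -> W) (u : U) (v : V) :
  bilinear2 f -> tlift f (u *t v) = f u v.
Proof.
case=> fr fl.
pose fr' u0 : {linear V -> W} := HB.pack (f u0) (GRing.isLinear.Build _ _ _ _ _ (fr u0)).
pose fl' v0 : {linear U -> W} := HB.pack (f^~ v0) (GRing.isLinear.Build _ _ _ _ _ (fl v0)).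
have -> : f u v = fl' v u by [].
rewrite {2}[u]can_basis_sum linear_sum; apply: eq_bigr => i _.
have -> : fl' v (v2r u 0 i *: can_basis i) =
          v2r u 0 i *: fr' (can_basis i) v by rewrite linearZ.
rewrite {2}[v]can_basis_sum linear_sum scaler_sumr; apply: eq_bigr => j _.
by rewrite linearZ scalerA /tens !mxE big_ord1 !mxE.
Qed.

Lemma tensor_ext (f g : {linear tensor U V -> W}) :
  (forall u v, f (u *t v) = g (u *t v)) -> f =1 g.
Proof.
move=> fg z; rewrite [z]tensor_sum !linear_sum; apply: eq_bigr => i _.
by rewrite !linear_sum; apply: eq_bigr => j _; rewrite !linearZ /= fg.
Qed.

End TensorTheory.

Section Comultiplication.
Variables (F : fieldType) (B : falgType F).
Local Notation BB := (tensor B B).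

Definition lact (a : B) : BB -> BB := tlift (fun b c => (a * b) *t c).
Definition ract (z : BB) (d : B) : BB := tlift (fun b c => b *t (c * d)) z.

Definition invariant_elt (y : BB) := forall a : B, lact a y = ract y a.

(* For an invariant y this is also the map sending a to [ract y a]. *)
Definition comult (y : BB) (a : B) : BB := lact a y.

Definition bimodule_map (D : B -> BB) :=
  linear D /\ forall a b c : B, D (a * b * c) = ract (lact a (D b)) c.

(* The isomorphism sending (a *t b) *t c to a *t (b *t c). *)
Definition tassoc : tensor BB B -> tensor B BB :=
  tlift (fun z c => tlift (fun a b => a *t (b *t c)) z).

Definition coassociative (D : B -> BB) := forall a : B,
  tassoc (tlift (fun b c => D b *t c) (D a)) = tlift (fun b c => b *t D c) (D a).

Definition counit (D : B -> BB) (eps : {linear B -> F^o}) := forall a : B,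
  tlift (fun b c => eps b *: c) (D a) = a /\
  tlift (fun b c => (eps c : F) *: b) (D a) = a.

Definition induces_coassociative_counital (y : BB) :=
  [/\ invariant_elt y, coassociative (comult y)
    & exists eps : {linear B -> F^o}, counit (comult y) eps].

End Comultiplication.

Lemma memv_bigcap_seq (K : fieldType) (vT : vectType K) (I : Type) (r : seq I)
    (V : I -> {vspace vT}) (v : vT) :
  (v \in \bigcap_(x <- r) V x)%VS = all (fun x => v \in V x) r.
Proof.
by elim: r => [|x r IHr]; rewrite ?big_nil ?memvf // big_cons memv_cap IHr.
Qed.

Section RightModules.
Variables (F : fieldType) (L : falgType F).

(* Right L-modules are left modules over the converse ring L^c, and L^c^o is
   the right regular module. *)
Definition self_injective :=
  forall (M N : lmodType L^c) (i : {linear M -> N}) (f : {linear M -> L^c^o}),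
    injective i -> exists g : {linear N -> L^c^o}, forall x, g (i x) = f x.

Record right_ideal := RightIdeal {
  rideal_vspace :> {vspace L};
  ridealM : forall u a, u \in rideal_vspace -> u * a \in rideal_vspace }.

(* U / R and V are isomorphic right modules, for R <= U: two elements of U have
   the same image under f exactly when they lie in the same coset of R.  (The
   values of f outside U are irrelevant.) *)
Definition quotient_iso (U R V : {vspace L}) := exists f : 'End(L),
  [/\ forall u a, u \in U -> f (u * a) = f u * a,
      (f @: U)%VS = V
    & forall u v, u \in U -> v \in U -> (f u = f v <-> u - v \in R)].

Definition rmod_iso (U V : right_ideal) := quotient_iso U 0 V.

Definition simple_rmod (T : right_ideal) :=
  T != 0%VS :> {vspace L} /\
  forall T' : right_ideal, (T' <= T)%VS ->
    T' = 0%VS :> {vspace L} \/ T' = T :> {vspace L}.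

Definition maximal_submod (U N : right_ideal) :=
  [/\ (N <= U)%VS, N != U :> {vspace L}
    & forall N' : right_ideal, (N <= N')%VS -> (N' <= U)%VS ->
        N' = N :> {vspace L} \/ N' = U :> {vspace L}].

(* S is the sum of all simple submodules of U. *)
Definition is_socle (U : right_ideal) (S : {vspace L}) := forall x, x \in S <->
  exists (r : nat) (T : 'I_r -> right_ideal),
    (forall k, simple_rmod (T k) /\ (T k <= U)%VS) /\ x \in (\sum_k T k)%VS.

(* R is the intersection of all maximal submodules of U. *)
Definition is_radical (U : right_ideal) (R : {vspace L}) := forall x, x \in R <->
  x \in U /\ forall N : right_ideal, maximal_submod U N -> x \in N.

Definition indecomposable (U : right_ideal) :=
  U != 0%VS :> {vspace L} /\
  forall V W : right_ideal, (V + W)%VS = U -> (V :&: W)%VS = 0%VS ->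
    V = 0%VS :> {vspace L} \/ W = 0%VS :> {vspace L}.

Section Decomposition.
Variables (n : nat) (P : 'I_n -> right_ideal).

(* The summands are projective, as direct summands of the regular module. *)
Definition decomposition :=
  [/\ (\sum_i P i)%VS = fullv, directv (\sum_i P i)
    & forall i, indecomposable (P i)].

Definition basic := forall i j, i <> j -> ~ rmod_iso (P i) (P j).

(* soc (P i) is isomorphic to top (P (nu i)) = P (nu i) / rad (P (nu i)). *)
Definition nakayama (nu : 'S_n) := forall i, exists S R : {vspace L},
  [/\ is_socle (P i) S, is_radical (P (nu i)) R
    & quotient_iso (P (nu i)) R S].

(* The elements of L whose left multiplication maps P i to P j and vanishes on
   the other summands: morphisms P i -> P j, extended by zero. *)
Definition homv (i j : 'I_n) : {vspace L} :=
  (\bigcap_(l : 'I_n) \bigcap_(x <- vbasis (P l))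
     amulr x @^-1: (if l == i then rideal_vspace (P j) else 0))%VS.

Lemma homvP i j (a : L) :
  reflect ((forall x, x \in P i -> a * x \in P j) /\
           (forall l x, l != i -> x \in P l -> a * x = 0))
    (a \in homv i j).
Proof.
pose W l := if l == i then rideal_vspace (P j) else 0%VS.
suff hP : reflect (forall l x, x \in P l -> a * x \in W l) (a \in homv i j).
  apply: (iffP hP) => [h|[hi h0] l x Plx]; rewrite /W.
    split=> [x /h|l x /negPf li /h]; first by rewrite /W eqxx.
    by rewrite /W li memv0 => /eqP.
  by case: eqP Plx => [->|/eqP li] Plx; [apply: hi | rewrite (h0 l) ?mem0v].
have memE l : (a \in \bigcap_(x <- vbasis (P l)) amulr x @^-1: W l)%VS =
    all (fun x => a * x \in W l) (vbasis (P l)).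
  by rewrite memv_bigcap_seq; apply: eq_all => x; rewrite -memv_preim lfunE.
rewrite /homv memvE; apply: (iffP subv_bigcapP) => h l; last first.
  by move=> _; rewrite -memvE memE; apply/allP => x /vbasis_mem; apply: h.
move=> x /coord_vbasis ->; have := h l isT; rewrite -memvE memE => /allP hl.
rewrite mulr_sumr; apply: memv_suml => k _.
by rewrite -scalerAr memvZ // hl ?memt_nth.
Qed.

Section EndomorphismAlgebra.
Variable m : 'I_n -> nat.

(* The pair of i and s : 'I_(m i) indexes the copy P_{is} of P i, so that the
   direct sum of the P i ^ m(i) consists of the families v of elements of L
   with v (i, s) in P i. *)
Definition copy := {i : 'I_n & 'I_(m i)}.

Definition in_copy (i : 'I_n) (s : 'I_(m i)) : copy :=
  Tagged (fun k => 'I_(m k)) s.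

Definition coordinate (c : copy) (v : {ffun copy -> L}) : L := v c.

Fact coordinate_linear (c : copy) : linear (coordinate c).
Proof. by move=> a u v; rewrite /coordinate !ffunE. Qed.
HB.instance Definition _ (c : copy) :=
  GRing.isLinear.Build F {ffun copy -> L} L *:%R (coordinate c)
    (coordinate_linear c).

Definition dsumv : {vspace {ffun copy -> L}} :=
  (\bigcap_(c : copy) linfun (coordinate c) @^-1: P (tag c))%VS.

Lemma dsumvP (v : {ffun copy -> L}) :
  reflect (forall c, v c \in P (tag c)) (v \in dsumv).
Proof.
rewrite memvE; apply: (iffP subv_bigcapP) => h c; have := h c.
  by rewrite -memvE -memv_preim lfunE => /(_ isT).
by rewrite -memvE -memv_preim lfunE.
Qed.

Definition dsum := subvs_of dsumv.
HB.instance Definition _ := Vector.on dsum.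

Fact dsum_act_subproof (v : dsum) (a : L) :
  [ffun c => vsval v c * a] \in dsumv.
Proof.
by apply/dsumvP => c; rewrite ffunE ridealM //; apply/dsumvP/subvsP.
Qed.

Definition dsum_act (a : L) (v : dsum) : dsum :=
  Subvs (dsum_act_subproof v a).

Fact dsum_act_linear a : linear (dsum_act a).
Proof.
move=> k u v; apply: subvs_inj; apply/ffunP => c.
by rewrite linearP /= !ffunE mulrDl scalerAl.
Qed.
HB.instance Definition _ a :=
  GRing.isLinear.Build F dsum dsum *:%R (dsum_act a) (dsum_act_linear a).

Definition commutator_act (a : L) (f : 'End(dsum)) : 'End(dsum) :=
  ((f \o linfun (dsum_act a)) - (linfun (dsum_act a) \o f))%VF.

Fact commutator_act_linear a : linear (commutator_act a).
Proof.
move=> k f g; apply/lfunP => v.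
rewrite !(add_lfunE, opp_lfunE, scale_lfunE, comp_lfunE) linearP.
by rewrite scalerBr opprD addrACA.
Qed.
HB.instance Definition _ a :=
  GRing.isLinear.Build F 'End(dsum) 'End(dsum) *:%R (commutator_act a)
    (commutator_act_linear a).

Definition endv : {vspace 'End(dsum)} :=
  (\bigcap_(a <- vbasis {:L}) lker (linfun (commutator_act a)))%VS.

Lemma endvP (f : 'End(dsum)) :
  reflect (forall a v, f (dsum_act a v) = dsum_act a (f v)) (f \in endv).
Proof.
have comE a v : (commutator_act a f v == 0) =
    (f (dsum_act a v) == dsum_act a (f v)).
  by rewrite /commutator_act; do !rewrite lfunE /=; rewrite subr_eq0.
rewrite /endv memv_bigcap_seq; apply: (iffP allP) => h; last first.
  move=> a _; rewrite memv_ker lfunE /=; apply/eqP/lfunP => v.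
  by apply/eqP; rewrite [X in _ == X]lfunE comE h.
have actD : forall v, linear (dsum_act^~ v).
  move=> v k a b; apply: subvs_inj; apply/ffunP => c.
  by rewrite linearP /= !ffunE mulrDr scalerAr.
pose act v : {linear L -> dsum} :=
  HB.pack (dsum_act^~ v) (GRing.isLinear.Build _ _ _ _ _ (actD v)).
move=> a v; rewrite -!/(act _ a) -[LHS]/(f (act v a)) -[RHS]/(act (f v) a).
rewrite (coord_vbasis (memvf a)) !linear_sum; apply: eq_bigr => k _.
rewrite !linearZ /=; congr (_ *: _); apply/eqP; rewrite -comE.
have := h (vbasis fullv)`_k; rewrite memt_nth // memv_ker lfunE /=.
by move=> /(_ isT)/eqP ->; rewrite lfunE.
Qed.

(* The hypotheses make the algebra nonzero, as falgType requires. *)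
Definition endalg (dP : decomposition) (m_gt0 : forall i, (0 < m i)%N) :=
  subvs_of endv.

Section Algebra.
Variables (dP : decomposition) (m_gt0 : forall i, (0 < m i)%N).
Local Notation A := (endalg dP m_gt0).
HB.instance Definition _ := Vector.on A.

Fact end_one_subproof : (\1%VF : 'End(dsum)) \in endv.
Proof. by apply/endvP => a v; rewrite !lfunE. Qed.

Fact end_mul_subproof (f g : A) : (vsval f \o vsval g)%VF \in endv.
Proof.
by apply/endvP => a v; rewrite !comp_lfunE !(endvP _ (subvsP _)).
Qed.

Definition end_one : A := Subvs end_one_subproof.
Definition end_mul (f g : A) : A := Subvs (end_mul_subproof f g).

Fact end_mulA : associative end_mul.
Proof. by move=> f g h; apply: subvs_inj; apply: comp_lfunA. Qed.
Fact end_mul1l : left_id end_one end_mul.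
Proof. by move=> f; apply: subvs_inj; apply: comp_lfun1l. Qed.
Fact end_mul1r : right_id end_one end_mul.
Proof. by move=> f; apply: subvs_inj; apply: comp_lfun1r. Qed.
Fact end_mulDl : left_distributive end_mul +%R.
Proof. by move=> f g h; apply: subvs_inj; apply: comp_lfunDl. Qed.
Fact end_mulDr : right_distributive end_mul +%R.
Proof. by move=> f g h; apply: subvs_inj; apply: comp_lfunDr. Qed.
Fact end_one_neq0 : end_one != 0.
Proof.
case: dP => sumP _ indP.
have [i _]: exists i : 'I_n, True.
  case: (posnP n) => [n0|n_gt0]; last by exists (Ordinal n_gt0).
  have sum0 : (\sum_i P i)%VS = 0%VS.
    by apply: big1 => i _; move: (leq_ltn_trans (leq0n i) (ltn_ord i)); rewrite [X in (_ < X)%N]n0.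
  by have := oner_neq0 L; rewrite -memv0 -sum0 sumP memvf.
have [P_neq0 _] := indP i; pose s := Ordinal (m_gt0 i).
apply: contraNneq P_neq0 => /(congr1 val) /= one0.
apply/eqP/vspaceP => x; rewrite memv0; apply/idP/eqP => [Px|->]; last exact: mem0v.
pose c := in_copy s; pose v := [ffun c' => if c' == c then x else 0].
have vM : v \in dsumv.
  by apply/dsumvP => c'; rewrite ffunE; case: eqP => [->|_] //; apply: mem0v.
have /(congr1 (fun w : dsum => vsval w c)) := congr1 (fun f : 'End(dsum) => f (Subvs vM)) one0.
by rewrite !lfunE /= !ffunE eqxx.
Qed.

HB.instance Definition _ := GRing.Zmodule_isNzRing.Build A
  end_mulA end_mul1l end_mul1r end_mulDl end_mulDr end_one_neq0.

Fact end_scaleAl (k : F) (f g : A) : k *: (f * g) = (k *: f) * g.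
Proof. by apply: subvs_inj; apply: comp_lfunZl. Qed.
HB.instance Definition _ := GRing.Lmodule_isLalgebra.Build F A end_scaleAl.

Fact end_scaleAr (k : F) (f g : A) : k *: (f * g) = f * (k *: g).
Proof. by apply: subvs_inj; apply: comp_lfunZr. Qed.
HB.instance Definition _ := GRing.Lalgebra_isAlgebra.Build F A end_scaleAr.

HB.instance Definition _ := Algebra_isFalgebra.Build F A.

(* For phi : P i -> P j, the morphism P_{is} -> P_{jt} it induces, extended by
   zero on the other summands. *)
Section CopyMap.
Variables (i j : 'I_n) (t : 'I_(m j)) (s : 'I_(m i)).
Variable phi : subvs_of (homv i j).

Definition copy_map_family (v : dsum) : {ffun copy -> L} :=
  [ffun c => if c == in_copy t then vsval phi * vsval v (in_copy s) else 0].

Fact copy_map_family_subproof v : copy_map_family v \in dsumv.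
Proof.
apply/dsumvP => c; rewrite ffunE; case: eqP => [->|_]; last exact: mem0v.
have /dsumvP/(_ (in_copy s)) Pv := subvsP v.
by have /homvP[/(_ _ Pv)] := subvsP phi.
Qed.

Definition copy_map_fun (v : dsum) : dsum := Subvs (copy_map_family_subproof v).

Fact copy_map_linear : linear copy_map_fun.
Proof.
move=> a u v; apply: subvs_inj; apply/ffunP => c.
rewrite linearP /= !ffunE; case: eqP => _; last by rewrite scaler0 addr0.
by rewrite mulrDr -scalerAr.
Qed.
HB.instance Definition _ :=
  GRing.isLinear.Build F dsum dsum *:%R copy_map_fun copy_map_linear.

Fact copy_map_subproof : linfun copy_map_fun \in endv.
Proof.
apply/endvP => a v; rewrite !lfunE; apply: subvs_inj; apply/ffunP => c /=.
by rewrite !ffunE; case: eqP => _; rewrite ?mulrA ?mul0r.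
Qed.

Definition copy_map : A := Subvs copy_map_subproof.

End CopyMap.
End Algebra.
End EndomorphismAlgebra.
End Decomposition.
End RightModules.

Arguments copy_map {F L n P m} dP m_gt0 {i j} t s phi.

(* Main.v *)
(* Write 1 = sum_i e_i with e_i in P_i.  A morphism a : P_i -> P_j, put in position
   (d, c) among the copies, is a matrix unit E_{d,c}(a), and these span A.  In
   terms of them, x is the sum over i, over (s, s') in S(i) and over all copies
   c of (E_{c,(i,s)} (x) E_{(nu^-1 i,s'),c})(y): the components of y that do not
   match (i, c) are killed by the idempotents.  Multiplying by E_{d,c}(a) on the
   left leaves (E_{d,(i,s)} (x) E_{(nu^-1 i,s'),c})(a y), on the right the same
   with y a, so x inherits invariance from y, one pair (s, s') at a time.
   Coassociativity holds for every invariant x: both (Delta (x) id) Delta(a) and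
   (id (x) Delta) Delta(a) are obtained by inserting a between two copies of x. *)
From HB Require Import structures.
From mathcomp Require Import all_boot all_order all_fingroup all_algebra all_field.
(* Imported last: the action lact of Defs is otherwise shadowed by fingroup. *)
Require Import Defs.

Set Implicit Arguments.
Unset Strict Implicit.
Unset Printing Implicit Defensive.

Import GRing.Theory.
Local Open Scope ring_scope.

(** * Linearity and extensionality of maps out of tensor products *)

Section TensorMaps.
Variable F : fieldType.

HB.instance Definition _ (U V : vectType F) (u : U) :=
  GRing.isLinear.Build F V (tensor U V) *:%R (tens u) (@tens_linearr F U V u).

Lemma tensPl (U V : vectType F) k (u u' : U) (v : V) :
  (k *: u + u') *t v = k *: (u *t v) + u' *t v.
Proof. exact: tens_linearl. Qed.

Lemma tens0l (U V : vectType F) (v : V) : (0 : U) *t v = 0.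
Proof. by have := tensPl (-1) (0 : U) 0 v; rewrite scaler0 addr0 scaleN1r addNr. Qed.

(** A form of [tensor_ext] for plain functions, so that composites of lifts and actions can be
    compared on pure tensors without being bundled. *)
Lemma tlift_tensor_ext (U V W : vectType F) (f g : tensor U V -> W) :
  linear f -> linear g -> (forall u v, f (u *t v) = g (u *t v)) -> f =1 g.
Proof.
move=> lf lg.
pose f' : {linear _ -> _} := HB.pack f (GRing.isLinear.Build _ _ _ _ _ lf).
pose g' : {linear _ -> _} := HB.pack g (GRing.isLinear.Build _ _ _ _ _ lg).
exact: (tensor_ext (f := f') (g := g')).
Qed.

(** Linearity of the actions in the acting element rests on this: that element is a parameter of the
    lifted map. *)
Lemma tlift_linear_fun (U V W : vectType F) k
    (f g f' : U -> V -> W) (z : tensor U V) :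
  (forall u v, f u v = k *: g u v + f' u v) ->
  tlift f z = k *: tlift g z + tlift f' z.
Proof.
move=> fE; rewrite /tlift scaler_sumr -big_split; apply: eq_bigr => i _ /=.
rewrite scaler_sumr -big_split; apply: eq_bigr => j _ /=.
by rewrite fE scalerDr !scalerA mulrC.
Qed.

Lemma tmap_bilinear (U V U' V' : vectType F) (f : U -> U') (g : V -> V') :
  linear f -> linear g -> bilinear2 (fun u v => f u *t g v).
Proof.
by move=> lf lg; split=> u k v w; rewrite ?lf ?lg ?tensPl ?linearP.
Qed.

End TensorMaps.

(** * Bimodule actions and coassociativity for invariant elements *)

Section InvariantElements.
Variables (F : fieldType) (B : falgType F).
Implicit Types (a b c : B) (z x : tensor B B).

HB.instance Definition _ a :=
  GRing.isLinear.Build F (tensor B B) (tensor B B) *:%R (@lact F B a)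
    (tlift_linear _).

Lemma lact_tens a b c : lact a (b *t c) = (a * b) *t c.
Proof.
apply: tlift_tens; apply: tmap_bilinear => // k u v.
by rewrite mulrDr scalerAr.
Qed.

Lemma ract_tens a b c : ract (b *t c) a = b *t (c * a).
Proof.
apply: tlift_tens; apply: (tmap_bilinear (f := id)) => // k u v.
by rewrite mulrDl scalerAl.
Qed.

Lemma lactPl x : linear (fun a => lact a x).
Proof.
move=> k a b; apply: tlift_linear_fun => // u v.
by rewrite mulrDl -scalerAl tensPl.
Qed.

Lemma ractPl a : linear (fun z => ract z a).
Proof. exact: tlift_linear. Qed.

Lemma ractPr x : linear (ract x).
Proof.
move=> k a b; apply: tlift_linear_fun => // u v.
by rewrite mulrDr -scalerAr linearP.
Qed.

Lemma lactM a b z : lact (a * b) z = lact a (lact b z).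
Proof.
move: z; apply: tlift_tensor_ext => [k u v|k u v|u v]; rewrite ?linearP //.
by rewrite !lact_tens mulrA.
Qed.

Lemma lact_ract a b z : lact a (ract z b) = ract (lact a z) b.
Proof.
move: z; apply: tlift_tensor_ext => [k u v|k u v|u v];
  rewrite ?(linearP, ractPl) //.
by rewrite !(lact_tens, ract_tens).
Qed.

Lemma invariant_bimodule_map x : invariant_elt x -> bimodule_map (comult x).
Proof.
move=> xP; split=> [|a b c]; first exact: lactPl.
by rewrite /comult lactM xP lact_ract lactM.
Qed.

Lemma invariant_coassociative x : invariant_elt x -> coassociative (comult x).
Proof.
move=> xP a.
(* [Phi z w] sets [z] and [w] side by side and multiplies the two middle factors; both sides of
   coassociativity take this form. *)
pose Phi z w : tensor B (tensor B B) := tlift (fun b c => b *t lact c w) z.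
have PhiB w : bilinear2 (fun b c => b *t lact c w).
  by apply: (tmap_bilinear (f := id)) => //; apply: lactPl.
have PhiT w b c : Phi (b *t c) w = b *t lact c w by apply: tlift_tens.
have Phil w : linear (Phi^~ w) by apply: tlift_linear.
have Phir z : linear (Phi z).
  by move=> k u v; apply: tlift_linear_fun => // b c; rewrite !linearP.
have assocT z c : tassoc (z *t c) = tlift (fun a b => a *t (b *t c)) z.
  apply: tlift_tens; split=> z' k u v; last by rewrite linearP.
  by apply: tlift_linear_fun => // b d; rewrite !linearP.
have left w : tassoc (tlift (fun b c => comult x b *t c) w) = Phi x w.
  move: w; apply: tlift_tensor_ext => // [k u v|b c].
    by rewrite linearP /tassoc linearP.
  rewrite tlift_tens; last first.
    by apply: (tmap_bilinear (g := id)) => //; apply: lactPl.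
  (* By invariance, [b] acts on the right of [x] rather than on the left, which places it in the
     middle factor. *)
  rewrite assocT /comult xP; move: x {xP}.
  apply: tlift_tensor_ext => [k u v|k u v|u v].
  - by rewrite ractPl linearP.
  - exact: Phil.
  rewrite ract_tens PhiT lact_tens tlift_tens //.
  by split=> d k p q; rewrite ?tensPl ?linearP.
(* What remains is Phi(x, ax) = Phi(xa, x): the element [a] slides across the middle product. *)
rewrite left -[RHS]/(Phi _ x) /comult [in RHS]xP.
have comm z : Phi z (lact a x) = Phi (ract z a) x.
  move: z; apply: tlift_tensor_ext => [k u v|k u v|u v].
  - exact: Phil.
  - by rewrite ractPl Phil.
  - by rewrite ract_tens !PhiT lactM.
exact: comm.
Qed.

End InvariantElements.

(** * Tensor products of linear maps and their behaviour under the actions *)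

Section TensorProductOfMaps.
Variable F : fieldType.

Definition tmap (U V U' V' : vectType F) (f : U -> U') (g : V -> V') :
  tensor U V -> tensor U' V' := tlift (fun u v => f u *t g v).

HB.instance Definition _ (U V U' V' : vectType F) (f : U -> U') (g : V -> V') :=
  GRing.isLinear.Build F (tensor U V) (tensor U' V') *:%R (tmap f g)
    (tlift_linear _).

Lemma tmap_tens (U V U' V' : vectType F) (f : {linear U -> U'})
    (g : {linear V -> V'}) u v : tmap f g (u *t v) = f u *t g v.
Proof. by apply: tlift_tens; apply: tmap_bilinear => k ? ?; rewrite linearP. Qed.

Variables B C : falgType F.

(** Meant for [f] and [f'] being matrix units with the same column: multiplying by [a'] changes the
    row, hence the passage from [f] to [f']. *)
Lemma lact_tmap (f f' g : {linear B -> C}) (a : B) (a' : C) (z : tensor B B) :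
  (forall b, a' * f b = f' (a * b)) ->
  lact a' (tmap f g z) = tmap f' g (lact a z).
Proof.
move=> ff'; move: z; apply: tlift_tensor_ext => [k u v|k u v|u v].
- by rewrite !linearP.
- by rewrite !linearP.
- by rewrite lact_tens !tmap_tens lact_tens ff'.
Qed.

Lemma lact_tmap0 (f g : {linear B -> C}) (a : C) (z : tensor B B) :
  (forall b, a * f b = 0) -> lact a (tmap f g z) = 0.
Proof.
move=> f0; move: z; apply: (tlift_tensor_ext (g := fun=> 0)) =>
  [k u v|k u v|u v].
- by rewrite !linearP.
- by rewrite scaler0 addr0.
- by rewrite tmap_tens lact_tens f0 tens0l.
Qed.

Lemma ract_tmap (f g g' : {linear B -> C}) (a : B) (a' : C) (z : tensor B B) :
  (forall b, g b * a' = g' (b * a)) ->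
  ract (tmap f g z) a' = tmap f g' (ract z a).
Proof.
move=> gg'; move: z; apply: tlift_tensor_ext => [k u v|k u v|u v].
- by rewrite linearP ractPl.
- by rewrite ractPl linearP.
- by rewrite ract_tens !tmap_tens ract_tens gg'.
Qed.

Lemma ract_tmap0 (f g : {linear B -> C}) (a : C) (z : tensor B B) :
  (forall b, g b * a = 0) -> ract (tmap f g z) a = 0.
Proof.
move=> g0; move: z; apply: (tlift_tensor_ext (g := fun=> 0)) =>
  [k u v|k u v|u v].
- by rewrite linearP ractPl.
- by rewrite scaler0 addr0.
- by rewrite tmap_tens ract_tens g0 linear0.
Qed.

End TensorProductOfMaps.

(** * Idempotents and matrix units in the endomorphism algebra *)

Section MatrixUnits.
Variables (F : fieldType) (L : falgType F) (n : nat).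
Variables (P : 'I_n -> right_ideal L) (dP : decomposition P).

(** The e_i are the components of 1. For x in P_j, the sum of the e_i x is x, and each e_i x lies in
    the right ideal P_i; uniqueness of components gives the last clause. *)
Lemma decomposition_idempotents : exists e : 'I_n -> L,
  [/\ forall i, e i \in P i, \sum_i e i = 1
    & forall i j x, x \in P j -> e i * x = if i == j then x else 0].
Proof.
have [sumP dirP _] := dP.
have /memv_sumP[e eP e1] : 1 \in (\sum_i P i)%VS by rewrite sumP memvf.
exists e; split=> [i||i j x Px]; [exact: eP | by [] |].
pose x_ k := if k == j then x else 0.
have x_P k : true -> x_ k \in P k.
  by rewrite /x_; case: eqP => [->|_] // _; apply: mem0v.
have exP k : true -> e k * x \in P k by move=> _; apply/ridealM/eP.
have := directv_sum_unique dirP _ _ exP x_P.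
rewrite -mulr_suml -e1 mul1r -big_mkcond big_pred1_eq eqxx.
by move=> /esym/forallP/(_ i)/eqP.
Qed.

Variables (m : 'I_n -> nat) (m_gt0 : forall i, (0 < m i)%N).
Local Notation A := (endalg dP m_gt0).
Implicit Types c d : copy m.

Variable e : 'I_n -> L.

(* Cutting a down by the idempotents extends copy_map from homv to a linear map
   on all of L. *)
Definition entry_map d c (a : L) : A :=
  copy_map dP m_gt0 (tagged d) (tagged c)
    (vsproj (homv P (tag c) (tag d)) (e (tag d) * a * e (tag c))).

Lemma endalg_ext (f g : A) :
  (forall v c, vsval (vsval f v) c = vsval (vsval g v) c) -> f = g.
Proof.
by move=> fg; apply/subvs_inj/lfunP => v; apply/subvs_inj/ffunP => c.
Qed.

Lemma in_copy_tagged c : in_copy (tagged c) = c.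
Proof. by case: c. Qed.

Lemma copy_mapE i j (t : 'I_(m j)) (s : 'I_(m i)) f v c :
  vsval (vsval (copy_map dP m_gt0 t s f : A) v) c =
  if c == in_copy t then vsval f * vsval v (in_copy s) else 0.
Proof. by rewrite lfunE /= ffunE. Qed.

Lemma copy_map0 i j (t : 'I_(m j)) (s : 'I_(m i)) :
  copy_map dP m_gt0 t s (0 : subvs_of (homv P i j)) = 0.
Proof.
by apply: endalg_ext => v c; rewrite copy_mapE mul0r if_same lfunE /= ffunE.
Qed.

Lemma entry_map_linear d c : linear (entry_map d c).
Proof.
move=> k a b; apply: endalg_ext => v l; rewrite copy_mapE.
rewrite linearP /= add_lfunE scale_lfunE linearP /= !ffunE !copy_mapE.
rewrite mulrDr mulrDl -scalerAr -scalerAl linearP linearP /=.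
by case: eqP => _; rewrite ?scaler0 ?addr0 // mulrDl scalerAl.
Qed.

HB.instance Definition _ d c :=
  GRing.isLinear.Build F L A *:%R (entry_map d c) (entry_map_linear d c).

Hypotheses (eP : forall i, e i \in P i) (e1 : \sum_i e i = 1).
Hypothesis eE : forall i j x, x \in P j -> e i * x = if i == j then x else 0.

Lemma idem_idem i j : e i * e j = if i == j then e j else 0.
Proof. exact: eE. Qed.

(** The right factor e_i kills the other summands, and a product starting with e_j stays in the
    right ideal P_j. *)
Lemma homv_idem i j a : e j * a * e i \in homv P i j.
Proof.
apply/homvP; split=> [x _|l x li Px]; first by rewrite -!mulrA ridealM.
by rewrite -!mulrA (eE i Px) eq_sym (negPf li) !mulr0.
Qed.

Lemma idem_homvr i j k a : a \in homv P i j -> a * e k = if k == i then a else 0.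
Proof.
case/homvP=> _ a0; have ae l : l != i -> a * e l = 0 by move=> /a0; apply.
case: eqP => [->|/eqP/ae //].
by rewrite -[RHS]mulr1 -e1 mulr_sumr (bigD1 i) //= big1 ?addr0.
Qed.

(** Since a = a e_i with e_i in P_i, the element [a] itself lies in P_j, where e_k acts by 0 or
    1. *)
Lemma idem_homvl i j k a : a \in homv P i j -> e k * a = if k == j then a else 0.
Proof.
move=> aP; have := idem_homvr i aP; rewrite eqxx => <-; rewrite mulrA.
have /homvP[aPj _] := aP.
by rewrite -mulrA (eE k (aPj _ (eP i))).
Qed.

(** The right idempotent disappears because it fixes [v c], an element of P (tag c). *)
Lemma entry_mapE d c a v l : vsval (vsval (entry_map d c a) v) l =
  if l == d then e (tag d) * a * vsval v c else 0.
Proof.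
rewrite copy_mapE !in_copy_tagged vsprojK ?homv_idem //.
case: eqP => // _; have /dsumvP/(_ c) vP := subvsP v.
by rewrite -[_ * _ * vsval v c]mulrA (eE _ vP) eqxx.
Qed.

Lemma entry_map_homv i j (t : 'I_(m j)) (s : 'I_(m i)) (f : subvs_of (homv P i j)) :
  copy_map dP m_gt0 t s f = entry_map (in_copy t) (in_copy s) (vsval f).
Proof.
rewrite /entry_map /= (idem_homvl _ (subvsP f)) eqxx.
by rewrite (idem_homvr _ (subvsP f)) eqxx vsvalK.
Qed.

Lemma entry_map0r d c i j a :
  a \in homv P i j -> tag c != i -> entry_map d c a = 0.
Proof.
move=> aP /negPf ci.
by rewrite /entry_map -mulrA (idem_homvr _ aP) ci mulr0 linear0 copy_map0.
Qed.

Lemma entry_map0l d c i j a :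
  a \in homv P i j -> tag d != j -> entry_map d c a = 0.
Proof.
move=> aP /negPf dj.
by rewrite /entry_map (idem_homvl _ aP) dj !mul0r linear0 copy_map0.
Qed.

Lemma entry_map_idem d c a :
  entry_map d c (e (tag d) * a * e (tag c)) = entry_map d c a.
Proof.
congr copy_map; congr vsproj.
by rewrite !mulrA idem_idem eqxx -!mulrA idem_idem eqxx.
Qed.

(** The idempotent in the middle records that the composite passes through P (tag c), as [a] and [b]
    are arbitrary elements of [L]. *)
Lemma entry_mapM d c c' d' a b : entry_map d c a * entry_map c' d' b =
  if c == c' then entry_map d d' (a * e (tag c) * b) else 0.
Proof.
apply: endalg_ext => v l.
rewrite comp_lfunE entry_mapE entry_mapE.
case: (c =P c') => [->|_].
  by rewrite entry_mapE; case: eqP; rewrite // !mulrA.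
by rewrite mulr0 if_same lfunE /= ffunE.
Qed.

Lemma insertion_subproof c : [ffun d => if d == c then e (tag c) else 0] \in dsumv P m.
Proof.
by apply/dsumvP => d; rewrite ffunE; case: eqP => [->|_]; rewrite ?eP ?mem0v.
Qed.

(** The canonical generator of the copy [c] as a right module. *)
Definition insertion c : dsum P m := Subvs (insertion_subproof c).

Lemma dsum_decomposition (v : dsum P m) :
  v = \sum_c dsum_act (vsval v c) (insertion c).
Proof.
apply/subvs_inj/ffunP => d; rewrite linear_sum sum_ffunE (bigD1 d) //= big1.
  rewrite !ffunE eqxx addr0; have /dsumvP/(_ d) vP := subvsP v.
  by rewrite (eE _ vP) eqxx.
by move=> c cd; rewrite !ffunE eq_sym (negPf cd) mul0r.
Qed.

(** An endomorphism is determined by its values on the generators [insertion c]; the components of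
    these values are its matrix entries. *)
Lemma entry_map_span (f : A) :
  f = \sum_d \sum_c entry_map d c (vsval (vsval f (insertion c)) d).
Proof.
apply: endalg_ext => v l.
rewrite {1}[v]dsum_decomposition !linear_sum /= !sum_lfunE !linear_sum /=.
rewrite !sum_ffunE.
rewrite [RHS](bigD1 l) //= [X in _ + X]big1 ?addr0 => [|d dl].
  rewrite linear_sum sum_lfunE linear_sum sum_ffunE; apply: eq_bigr => c _.
  rewrite entry_mapE eqxx (endvP _ (subvsP f)) ffunE.
  have /dsumvP/(_ l) vP := subvsP (vsval f (insertion c)).
  by rewrite (eE _ vP) eqxx.
rewrite linear_sum sum_lfunE linear_sum sum_ffunE big1 // => c _.
by rewrite entry_mapE eq_sym (negPf dl).
Qed.

Lemma invariant_entry_map (x : tensor A A) :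
  (forall d c a, lact (entry_map d c a) x = ract x (entry_map d c a)) ->
  invariant_elt x.
Proof.
move=> xP a.
pose l : {linear A -> tensor A A} :=
  HB.pack (fun b : A => lact b x) (GRing.isLinear.Build _ _ _ _ _ (lactPl x)).
pose r : {linear A -> tensor A A} :=
  HB.pack (ract x) (GRing.isLinear.Build _ _ _ _ _ (ractPr x)).
rewrite -[LHS]/(l a) -[RHS]/(r a) [a]entry_map_span !linear_sum.
by apply: eq_bigr => d _; rewrite !linear_sum; apply: eq_bigr => c _; apply: xP.
Qed.

Variables (I : finType) (Q : pred I) (src tgt : I -> copy m) (y : tensor L L).

(** Each index [k] contributes an invariant element on its own, which is why the sets S(i) can be
    chosen freely. *)
Lemma invariant_entry_sum : invariant_elt y ->
  invariant_elt (\sum_(k | Q k) \sum_c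
    tmap (entry_map c (src k)) (entry_map (tgt k) c) y).
Proof.
move=> yP; apply: invariant_entry_map => d c a.
(* Once [a] is cut down to its corner, it absorbs the idempotent produced by [entry_mapM], so that
   exactly [a'] acts on [y] from either side. *)
rewrite -entry_map_idem; set a' := _ * a * _.
pose r : {linear tensor A A -> tensor A A} :=
  HB.pack (fun z : tensor A A => ract z (entry_map d c a'))
    (GRing.isLinear.Build _ _ _ _ _ (@ractPl F A _)).
rewrite -[RHS]/(r _) !linear_sum; apply: eq_bigr => k _.
(* On the left only the summand indexed by [c] survives, on the right only the one indexed by
   [d]. *)
rewrite !linear_sum [LHS](bigD1 c) //= big1 ?addr0 => [|c' c'c]; last first.
  by apply: lact_tmap0 => b; rewrite entry_mapM eq_sym (negPf c'c).
rewrite [RHS](bigD1 d) //= [X in _ + X]big1 ?addr0 => [|d' d'd]; last first.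
  by apply: ract_tmap0 => b; rewrite entry_mapM (negPf d'd).
rewrite /r /= (@lact_tmap _ _ _ _ (entry_map d (src k)) _ a').
  rewrite (@ract_tmap _ _ _ _ _ (entry_map (tgt k) c) a') ?yP // => b.
  by rewrite entry_mapM eqxx /a' !mulrA -[b * e _ * e _]mulrA idem_idem eqxx.
move=> b; rewrite entry_mapM eqxx /a'; congr entry_map.
by rewrite -[_ * e _ * e _]mulrA idem_idem eqxx.
Qed.

End MatrixUnits.

Theorem theorem2p7 (F : fieldType) (L : falgType F)
    (L_self_injective : self_injective L)
    (n : nat) (P : 'I_n -> right_ideal L) (dP : decomposition P)
    (L_basic : basic P) (nu : 'S_n) (nuP : nakayama P nu)
    (m : 'I_n -> nat) (m_gt0 : forall i, (0 < m i)%N)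
    (K : 'I_n -> 'I_n -> nat)
    (phi : forall i j : 'I_n, 'I_(K i j) -> subvs_of (homv P i j))
    (psi : forall i j : 'I_n,
       'I_(K i j) -> subvs_of (homv P j ((nu^-1)%g i)))
    (S : forall i : 'I_n, {set 'I_(m i) * 'I_(m ((nu^-1)%g i))}) :
  let A : falgType F := endalg dP m_gt0 in
  let y : tensor L L :=
    \sum_i \sum_j \sum_b (vsval (phi i j b) *t vsval (psi i j b)) in
  let x : tensor A A :=
    \sum_i \sum_j \sum_(t < m j) \sum_b \sum_(ss in S i)
      (copy_map dP m_gt0 t ss.1 (phi i j b) *t
       copy_map dP m_gt0 ss.2 t (psi i j b)) in
  induces_coassociative_counital y ->
  invariant_elt x /\ bimodule_map (comult x) /\ coassociative (comult x).
Proof.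
move=> A y x [yP _ _].
suff xP : invariant_elt x.
  split=> //; split; first exact: invariant_bimodule_map.
  exact: invariant_coassociative.
have [e [eP e1 eE]] := decomposition_idempotents dP.
(* All triples (i, s, s'); membership of (s, s') in S(i) is imposed by the predicate of the sum. *)
pose I := {i : 'I_n & 'I_(m i) * 'I_(m ((nu^-1)%g i))}%type.
pose src (k : I) : copy m := in_copy (tagged k).1.
pose tgt (k : I) : copy m := in_copy (tagged k).2.
suff -> : x = \sum_(k | tagged k \in S (tag k)) \sum_c
    tmap (entry_map dP m_gt0 e c (src k)) (entry_map dP m_gt0 e (tgt k) c) y.
  exact: invariant_entry_sum.
rewrite -(sig_big_dep xpredT (fun i ss => ss \in S i) (fun i ss => \sum_c
   tmap (entry_map dP m_gt0 e c (in_copy ss.1))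
        (entry_map dP m_gt0 e (in_copy ss.2) c) y)).
apply: eq_bigr => i _; rewrite [RHS]exchange_big.
(* The indices j and t merge into the single copy c = (j, t). *)
rewrite (sig_big_dep xpredT (fun _ => xpredT) (fun j t => \sum_b \sum_(ss in S i)
  (copy_map dP m_gt0 t ss.1 (phi i j b) *t
   copy_map dP m_gt0 ss.2 t (psi i j b)))).
apply: eq_bigr => c _; rewrite exchange_big; apply: eq_bigr => ss _.
(* The first tensor factor selects the component of [y]: its source must be P_i, and its target,
   below, P (tag c). *)
rewrite linear_sum (bigD1 i) //= [X in _ + X]big1 ?addr0 => [|i' i'i]; last first.
  rewrite linear_sum big1 // => j _; rewrite linear_sum big1 // => b _.
  rewrite /= tmap_tens /=.
  rewrite (entry_map0r dP m_gt0 eP e1 _ (subvsP (phi i' j b))) ?tens0l //.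
  by rewrite /= eq_sym.
rewrite linear_sum (bigD1 (tag c)) //= [X in _ + X]big1 ?addr0 => [|j jc]; last first.
  rewrite linear_sum big1 // => b _.
  rewrite /= tmap_tens /=.
  rewrite (entry_map0l dP m_gt0 eP e1 eE _ (subvsP (phi i j b))) ?tens0l //.
  by rewrite /= eq_sym.
rewrite linear_sum; apply: eq_bigr => b _; rewrite /= tmap_tens /=.
by rewrite !(entry_map_homv dP m_gt0 eP e1 eE) in_copy_tagged.
Qed.
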